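(* Let $R$ be an integral domain with field of fractions $F$, let $f,g\in R[X]$ be monic polynomials of degree $n\ge1$ with companion matrices $C,D\in M_n(R)$, let $d=\gcd(f,g)\in F[X]$ and $h=f/d\in F[X]$. Suppose that $h\in R[X]$ (this is automatic if $R$ is integrally closed). Let $M=R\langle C,D\rangle/R[C]$, viewed as an $R[X]$-module via $C$, and let $D_j=D^j+R[C]\in M$ for $1\le j\le n-1$. Then $M$ has the cyclic decomposition $$M=R[X]\cdot D_1\oplus\cdots\oplus R[X]\cdot D_{n-1},$$ where the annihilating ideals are $R[X]h,\dots,R[X]h$, with $n-1$ repetitions; i.e. the invariant factors of $M$ are $h,\dots,h$, with $n-1$ repetitions.
   Context: For monic $f=f_0+f_1X+\cdots+f_{n-1}X^{n-1}+X^n\in R[X]$ the companion matrix $C_f\in M_n(R)$ has $1$'s on the first subdiagonal, last column $(-f_0,\dots,-f_{n-1})^T$, and $0$'s elsewhere. $R\langle C,D\rangle$ is the unital $R$-subalgebra of $M_n(R)$ generated by $C$ and $D$, and $R[C]$ the one generated by $C$. The gcd is monic. $M_n(R)$ is an $R[X]$-module via $C$ by $p(X)\cdot A=p(C)A$ for $p\in R[X]$, $A\in M_n(R)$; $R[C]\subseteq R\langle C,D\rangle$ are $R[X]$-submodules, and $M$ carries the quotient module structure. *)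

(* Defs.v *)
From HB Require Import structures.
From mathcomp Require Import all_boot all_algebra.
From mathcomp Require Import boolp classical_sets.

Set Implicit Arguments.
Unset Strict Implicit.
Unset Printing Implicit Defensive.

Import GRing.Theory.
Local Open Scope ring_scope.
Local Open Scope quotient_scope.

(* The module V / U, on top of the library quotient of abelian groups.       *)
Section QuotientModule.
Variables (S : nzRingType) (V : lmodType S) (U : V -> bool).
Hypothesis U_closed : GRing.submod_closed U.

Definition submod_zmodClosed : zmodClosed V :=
  HB.pack U (GRing.isZmodClosed.Build V U (GRing.submod_closedB U_closed)).

Definition quot_lmod : Type := Quotient.quot submod_zmodClosed.
HB.instance Definition _ := GRing.Zmodule.on quot_lmod.

Definition quot_proj (v : V) : quot_lmod := \pi_(Quotient.quot submod_zmodClosed) v.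

Definition quot_repr (q : quot_lmod) : V :=
  repr (q : Quotient.quot submod_zmodClosed).

Lemma quot_projP v w : quot_proj v = quot_proj w <-> v - w \in U.
Proof.
have -> : (v - w \in U) = (v == w %[mod Quotient.quot submod_zmodClosed]).
  exact: (Quotient.idealrBE submod_zmodClosed).
by split=> /eqP.
Qed.

Lemma quot_reprK : cancel quot_repr quot_proj.
Proof. exact: reprK. Qed.

Lemma quot_projD : {morph quot_proj : v w / v + w}.
Proof. exact: (raddfD (\pi_(Quotient.quot submod_zmodClosed))). Qed.

Definition quot_scale (a : S) (q : quot_lmod) : quot_lmod :=
  quot_proj (a *: quot_repr q).

Lemma quot_scale_proj a v : quot_scale a (quot_proj v) = quot_proj (a *: v).
Proof.
have UZ := GRing.subsemimod_closedZ (GRing.submod_closed_semi U_closed).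
by apply/quot_projP; rewrite -scalerBr; apply/UZ/quot_projP/quot_reprK.
Qed.

Lemma quot_scaleA a b q : quot_scale a (quot_scale b q) = quot_scale (a * b) q.
Proof. by rewrite -[q]quot_reprK !quot_scale_proj scalerA. Qed.

Lemma quot_scale1 : left_id 1 quot_scale.
Proof. by move=> q; rewrite -[q]quot_reprK quot_scale_proj scale1r. Qed.

Lemma quot_scaleDr : right_distributive quot_scale +%R.
Proof.
move=> a q r; rewrite -[q]quot_reprK -[r]quot_reprK -quot_projD.
by rewrite !quot_scale_proj -quot_projD scalerDr.
Qed.

Lemma quot_scaleDl q : {morph quot_scale^~ q : a b / a + b}.
Proof.
by move=> a b; rewrite -[q]quot_reprK !quot_scale_proj -quot_projD scalerDl.
Qed.

HB.instance Definition _ := GRing.Zmodule_isLmodule.Build S quot_lmod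
  quot_scaleA quot_scale1 quot_scaleDr quot_scaleDl.

Lemma quot_proj_is_linear : linear quot_proj.
Proof. by move=> a v w; rewrite quot_projD -quot_scale_proj. Qed.
HB.instance Definition _ :=
  GRing.isLinear.Build S V quot_lmod *:%R quot_proj quot_proj_is_linear.

End QuotientModule.

Section CyclicDecomposition.
Variables (S : comNzRingType) (V : lmodType S).
Local Open Scope classical_set_scope.

Definition cyclic_submod (x : V) : set V := range (fun a : S => a *: x).

Definition annihilator (x : V) : set S := [set a | a *: x = 0].

Definition principal_ideal (a : S) : set S := range (fun b : S => b * a).

Definition internal_direct_sum (k : nat) (W : 'I_k -> set V) : Prop :=
  forall v : V, exists! w : {ffun 'I_k -> V},
    (forall i, W i (w i)) /\ v = \sum_(i < k) w i.

Definition cyclic_decomposition (k : nat) (x : 'I_k -> V) (a : 'I_k -> S) : Prop :=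
  internal_direct_sum (fun i => cyclic_submod (x i)) /\
  forall i, annihilator (x i) = principal_ideal (a i).

(* Units are allowed in the list, as V may vanish (with f = g below).        *)
Definition invariant_factors (s : seq S) : Prop :=
  (forall i j : 'I_(size s), (i <= j)%N -> exists c, s`_j = c * s`_i) /\
  exists x : 'I_(size s) -> V, cyclic_decomposition x (fun i => s`_i).

End CyclicDecomposition.

Section GeneratedSubalgebra.
Variables (R : comNzRingType) (A : algType R) (X : set A).
Local Open Scope classical_set_scope.

Definition gen_alg : set A :=
  smallest [set B : set A | GRing.subalg_closed [in B]] X.

Lemma sub_gen_alg : X `<=` gen_alg.
Proof. exact: sub_gen_smallest. Qed.

Lemma gen_alg_closed : GRing.subalg_closed [in gen_alg].
Proof.
split=> [|a u v|u v]; rewrite !inE /=.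
- by move=> B [[+ _ _] _]; rewrite inE.
- move=> uG vG B BP; have [[_ + _] _] := BP => /(_ a u v).
  by rewrite !inE; apply; [apply: uG | apply: vG].
- move=> uG vG B BP; have [[_ _ +] _] := BP => /(_ u v).
  by rewrite !inE; apply; [apply: uG | apply: vG].
Qed.

End GeneratedSubalgebra.

Section CompanionModule.
Variable R : comNzRingType.

(* The transpose of the library's companionmx, with the size made explicit.  *)
Definition companion (n : nat) (f : {poly R}) : 'M[R]_n.+1 :=
  \matrix_(i, j) (if j == n :> nat then - f`_i else (i == j.+1 :> nat)%:R).

Variable n : nat.

(* M_n(R) as an R[X]-module via C: an alias, as p *: A depends on C.         *)
Definition mx_via (C : 'M[R]_n.+1) : Type := 'M[R]_n.+1.
HB.instance Definition _ C := GRing.Zmodule.on (mx_via C).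

Section Via.
Variable C : 'M[R]_n.+1.

Definition via_scale (p : {poly R}) (A : mx_via C) : mx_via C :=
  horner_mx C p *m A.

Lemma via_scaleA p q A : via_scale p (via_scale q A) = via_scale (p * q) A.
Proof. by rewrite /via_scale mulmxA rmorphM. Qed.

Lemma via_scale1 : left_id 1 via_scale.
Proof. by move=> A; rewrite /via_scale rmorph1 mul1mx. Qed.

Lemma via_scaleDr : right_distributive via_scale +%R.
Proof. by move=> p A B; apply: mulmxDr. Qed.

Lemma via_scaleDl A : {morph via_scale^~ A : p q / p + q}.
Proof. by move=> p q; rewrite /via_scale rmorphD; apply: mulmxDl. Qed.

HB.instance Definition _ := GRing.Zmodule_isLmodule.Build {poly R} (mx_via C)
  via_scaleA via_scale1 via_scaleDr via_scaleDl.

Lemma horner_gen_alg (X : set 'M[R]_n.+1) p : X C -> gen_alg X (horner_mx C p).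
Proof.
move=> XC; have [G1 GL GM] := gen_alg_closed X; rewrite -in_setE.
have CG : C \in gen_alg X by rewrite inE; apply: sub_gen_alg.
elim/poly_ind: p => [|p c pG].
  by rewrite rmorph0 -(addNr 1) -scaleN1r; apply: GL.
rewrite rmorphD rmorphM /= horner_mx_X horner_mx_C addrC -scalemx1.
by apply: GL => //; apply: GM.
Qed.

Lemma gen_alg_submod (X : set 'M[R]_n.+1) :
  X C -> GRing.submod_closed ([in gen_alg X] : {pred mx_via C}).
Proof.
move=> XC; have [G1 GL GM] := gen_alg_closed X; split.
  by rewrite -[0](addNr (1 : 'M[R]_n.+1)) -scaleN1r; apply: GL.
move=> p A B AG BG; rewrite -[p *: A](@scale1r R 'M[R]_n.+1).
by apply: GL => //; apply: GM => //; rewrite inE; apply: horner_gen_alg.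
Qed.

End Via.

Section Quotient.
Variables C D : 'M[R]_n.+1.

(* R<C,D> and R[C], inside the R[X]-module M_n(R).                           *)
Definition in_algCD : {pred mx_via C} := [in gen_alg [set C; D]%classic].
Definition in_algC : {pred mx_via C} := [in gen_alg [set C]%classic].

Lemma in_algCD_submod : GRing.submod_closed in_algCD.
Proof. by apply: gen_alg_submod; left. Qed.
HB.instance Definition _ := GRing.isSubmodClosed.Build {poly R} (mx_via C) in_algCD
  (GRing.submod_closed_semi in_algCD_submod).

Definition algCD : Type := {A : mx_via C | A \in in_algCD}.
HB.instance Definition _ := SubType.on algCD.
HB.instance Definition _ := SubChoice.on algCD.
HB.instance Definition _ := [SubChoice_isSubLmodule of algCD by <:].

Definition algC_in_algCD : algCD -> bool := fun A => val A \in in_algC.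

Lemma algC_in_algCD_submod : GRing.submod_closed algC_in_algCD.
Proof.
have [G0 GL] : GRing.submod_closed in_algC by apply: gen_alg_submod.
split=> [|p A B AG BG]; rewrite unfold_in /algC_in_algCD.
  by rewrite raddf0.
by rewrite linearP; apply: GL.
Qed.

Definition quot_algCD : Type := quot_lmod algC_in_algCD_submod.
HB.instance Definition _ := GRing.Lmodule.on quot_algCD.

Lemma expD_algCD j : (D ^+ j : mx_via C) \in in_algCD.
Proof.
have [G1 _ GM] := gen_alg_closed [set C; D]%classic.
have DG : D \in gen_alg [set C; D]%classic by rewrite inE; apply: sub_gen_alg; right.
elim: j => [|j IH]; first by rewrite expr0.
by rewrite exprS; apply: GM.
Qed.

Definition expD_class (j : nat) : quot_algCD :=
  quot_proj algC_in_algCD_submod (Sub (D ^+ j : mx_via C) (expD_algCD j)).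

End Quotient.
End CompanionModule.

Section Fractions.
Variable R : idomainType.

Definition frac_poly (p : {poly R}) : {poly {fraction R}} :=
  map_poly (@tofrac R) p.

Definition integrally_closed : Prop :=
  forall x : {fraction R}, integralOver (@tofrac R) x -> exists r, x = tofrac r.

End Fractions.

Definition monic_gcdp (F : fieldType) (p q : {poly F}) : {poly F} :=
  (lead_coef (gcdp p q))^-1 *: gcdp p q.

(* Main.v *)
Require Import Defs.
From HB Require Import structures.
From mathcomp Require Import all_boot all_algebra all_field.
From mathcomp Require Import boolp classical_sets.

Set Implicit Arguments.
Unset Strict Implicit.
Unset Printing Implicit Defensive.

Import GRing.Theory.
Local Open Scope ring_scope.

(** Put N = n + 1, so that C and D are N x N matrices with columns indexed by
    0, ..., n, and let e_k be the k-th basis column.  Two facts carry the proof.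

    First, C and D differ only in the last column: D - C = v e_n^T, where v is
    the column of coefficients of f - g ([companion_sub]).  Second, e_0 is a
    cyclic vector for C: R^N is R[X]/(f) with e_k = C^k e_0, so that
    v = (f - g)(C) e_0, and p(C) e_0 = 0 only if f divides p
    ([horner_companion_basis0_eq0]).

    Spanning.  The row e_n^T is cyclic for D ([basis_row_cyclic]), so for every
    matrix A there is a polynomial q with e_n^T A = e_n^T q(D), whence
    (D - C) A = (D - C) q(D).  Writing D A = C A + (D - C) A then shows that
    the sum of the R[C] D^j, for j <= n, is stable under left multiplication
    by C and by D.  As it contains 1, it is all of R<C,D>
    ([gen_alg_companions]), and the D_j with 1 <= j <= n span M.

    Annihilation.  As f divides h g, it divides h (f - g), so that
    h(C) (D - C) = 0; hence h(C) D^j = h(C) C^j belongs to R[C]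
    ([horner_mul_companion_exp]).

    Independence.  Let sum_j p_j(C) D^j = q(C), with 1 <= j <= n.  On e_0 the
    powers D^j and C^j agree, so sum_j p_j(C) C^j and q(C) agree on e_0, hence
    are equal, and sum_j p_j(C) (D^j - C^j) = 0.  The matrix D^j - C^j kills
    e_0, ..., e_(n - j) and sends e_(N - j) to v.  Going down from j = n, where
    the terms of higher index vanish by annihilation, the column N - j gives
    p_j(C) v = 0; so f divides p_j (f - g), hence p_j g, which means that h
    divides p_j ([companion_sum_independent], [cofactor_min]).

    That h has coefficients in R when R is integrally closed is a classical
    form of the lemma of Gauss: a monic divisor over a field of a monic
    polynomial over R has coefficients integral over R
    ([integral_coef_dvdp]). *)

(** * Companion matrices and their cyclic vectors *)

Section CompanionMatrix.
Variables (R : comNzRingType) (n : nat).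
Implicit Types (f g p : {poly R}) (k : nat).

(** The basis column e_k; meaningful for k <= n only, as [inord] is. *)
Definition basis_col k : 'cV[R]_n.+1 := delta_mx (inord k) 0.

(** The column of the coefficients of p of degree at most n. *)
Definition coef_col p : 'cV[R]_n.+1 := \col_i p`_i.

Lemma companion_basis_col f k :
  (k < n)%N -> companion n f *m basis_col k = basis_col k.+1.
Proof.
move=> lt_kn; apply/colP=> i; rewrite -colE !mxE inordK ?ltnS ?(ltnW lt_kn) //.
by rewrite ltn_eqF // eqxx andbT -val_eqE /= inordK.
Qed.

Lemma companion_basis_last f : companion n f *m basis_col n = - coef_col f.
Proof. by apply/colP=> i; rewrite -colE !mxE inordK // eqxx. Qed.

Lemma companion_exp_basis f j k :
  (k + j <= n)%N -> companion n f ^+ j *m basis_col k = basis_col (k + j).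
Proof.
elim: j k => [|j IHj] k le_kj; first by rewrite expr0 mul1mx addn0.
rewrite exprSr -mulmxA companion_basis_col; last first.
  by apply: leq_trans le_kj; rewrite addnS ltnS leq_addr.
by rewrite IHj addSnnS.
Qed.

Lemma horner_mx_sum (A : 'M[R]_n.+1) p m :
  (size p <= m)%N -> horner_mx A p = \sum_(i < m) p`_i *: A ^+ i.
Proof.
move=> le_pm; have {1}-> : p = \poly_(i < m) p`_i.
  apply/polyP=> i; rewrite coef_poly.
  by case: ltnP => // /(leq_trans le_pm)/leq_sizeP->.
rewrite poly_def raddf_sum; apply: eq_bigr => i _ /=.
by rewrite linearZ /= rmorphXn /= horner_mx_X.
Qed.

Lemma horner_companion_basis0 f p :
  (size p <= n.+1)%N -> horner_mx (companion n f) p *m basis_col 0 = coef_col p.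
Proof.
move=> le_pn; rewrite (horner_mx_sum _ le_pn) mulmx_suml.
rewrite (eq_bigr (fun i : 'I_n.+1 => p`_i *: basis_col i)) => [|i _]; last first.
  by rewrite -scalemxAl companion_exp_basis ?add0n // -ltnS.
apply/colP=> i; rewrite summxE (bigD1 i) //= !mxE inord_val !eqxx mulr1.
rewrite big1 ?addr0 // => j /negPf ne_ji.
by rewrite !mxE inord_val eq_sym ne_ji mulr0.
Qed.

(** The Cayley-Hamilton identity f(C) = 0, which only has to be checked on the
    cyclic vector e_0. *)
Lemma horner_companion_self f :
  f \is monic -> size f = n.+2 -> horner_mx (companion n f) f = 0.
Proof.
set C := companion n f => f_mon f_size.
have fC0 : horner_mx C f *m basis_col 0 = 0.
  have le_f : (size f <= n.+2)%N by rewrite f_size.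
  rewrite (horner_mx_sum _ le_f) big_ord_recr mulmxDl /=.
  have -> : f`_n.+1 = 1 by move/monicP: f_mon; rewrite lead_coefE f_size.
  rewrite scale1r exprS -mulmxA companion_exp_basis // add0n companion_basis_last.
  pose r := \poly_(i < n.+1) f`_i.
  have -> : coef_col f = coef_col r.
    by apply/colP=> i; rewrite !mxE coef_poly ltn_ord.
  have le_r : (size r <= n.+1)%N by apply: size_poly.
  rewrite -(horner_companion_basis0 f le_r) (horner_mx_sum _ le_r) -/C.
  apply/eqP; rewrite subr_eq0; apply/eqP; congr (_ *m _).
  by apply: eq_bigr => i _; rewrite coef_poly ltn_ord.
have fCk k : (k <= n)%N -> horner_mx C f *m basis_col k = 0.
  move=> le_kn; rewrite -(companion_exp_basis f (k := 0) (j := k)) // mulmxA.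
  have -> : horner_mx C f *m C ^+ k = C ^+ k *m horner_mx C f.
    by apply: commrX; apply: comm_horner_mx; apply: commr_refl.
  by rewrite -mulmxA fC0 mulmx0.
apply/matrixP=> i j; have /colP/(_ i) := fCk j (ltn_ord j : (j <= n)%N).
by rewrite /basis_col -colE inord_val !mxE.
Qed.


(** Only multiples of f annihilate the cyclic vector e_0: the remainder of p
    modulo f acts on it by its column of coefficients. *)
Lemma horner_companion_basis0_eq0 f p :
    f \is monic -> size f = n.+2 ->
  horner_mx (companion n f) p *m basis_col 0 = 0 -> exists q, p = q * f.
Proof.
move=> f_mon f_size; have p_eq := Pdiv.RingMonic.rdivp_eq f_mon p.
have le_r : (size (Pdiv.Ring.rmodp p f) <= n.+1)%N.
  by rewrite -ltnS -f_size Pdiv.Ring.ltn_rmodpN0 ?monic_neq0.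
rewrite {1}p_eq [horner_mx _ _]rmorphD rmorphM /=.
rewrite horner_companion_self // mulr0 add0r.
rewrite horner_companion_basis0 // => r0; exists (Pdiv.Ring.rdivp p f).
rewrite {1}p_eq; suff -> : Pdiv.Ring.rmodp p f = 0 by rewrite addr0.
apply/polyP=> i; rewrite coef0; case: (ltnP i n.+1) => [lt_in|].
  by have /colP/(_ (Ordinal lt_in)) := r0; rewrite !mxE.
by move/(leq_trans le_r)/leq_sizeP; apply.
Qed.

(** D - C has rank at most one, and only its last column can be nonzero. *)
Lemma companion_sub f g :
  companion n g - companion n f = coef_col (f - g) *m delta_mx 0 ord_max.
Proof.
apply/matrixP=> i j; rewrite [RHS]mxE big_ord1 !mxE coefB eqxx /=.
case: (j == ord_max) / eqP => [->|/eqP ne_j].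
  by rewrite eqxx mulr1 opprK addrC.
by rewrite mulr0; have /negPf-> : (j != n :> nat); rewrite ?subrr.
Qed.

Lemma size_monic_sub f g :
    f \is monic -> g \is monic -> size f = n.+2 -> size g = n.+2 ->
  (size (f - g)%R <= n.+1)%N.
Proof.
move=> /monicP + /monicP + sf sg; rewrite !lead_coefE sf sg /= => f1 g1.
apply/leq_sizeP=> i; rewrite leq_eqVlt => /orP[/eqP<-|lt_i].
  by rewrite coefB f1 g1 subrr.
by rewrite coefB !nth_default ?sf ?sg ?subrr.
Qed.

(** * The algebra generated by two companion matrices *)

Section Pair.
Variables (f g : {poly R}).
Hypotheses (f_monic : f \is monic) (g_monic : g \is monic).
Hypotheses (f_size : size f = n.+2) (g_size : size g = n.+2).
Let C := companion n f.
Let D := companion n g.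

Lemma horner_mul_companion_sub p :
  horner_mx C p *m (D - C) =
    (horner_mx C (p * (f - g)) *m basis_col 0) *m delta_mx 0 ord_max.
Proof.
rewrite companion_sub -(horner_companion_basis0 f) ?size_monic_sub //.
by rewrite rmorphM !mulmxA.
Qed.

Lemma horner_mul_companion_exp p j :
  (exists u, p * g = u * f) -> horner_mx C p *m D ^+ j = horner_mx C p *m C ^+ j.
Proof.
case=> u p_g; have pDC : horner_mx C p *m D = horner_mx C p *m C.
  apply/eqP; rewrite -subr_eq0 -mulmxBr horner_mul_companion_sub mulrBr p_g -mulrBl.
  by rewrite rmorphM /= horner_companion_self // mulr0 !mul0mx.
elim: j => [|j IHj] //.
have pC : horner_mx C p * C ^+ j = C ^+ j * horner_mx C p.
  by apply: commrX; apply: comm_horner_mx; apply: commr_refl.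
rewrite exprSr [C ^+ j.+1]exprSr -[LHS]/(horner_mx C p * (D ^+ j * D)) mulrA.
rewrite [horner_mx C p * _]IHj [_ *m C ^+ j]pC -mulrA.
by rewrite [horner_mx C p * D]pDC -[_ *m C]/(_ * C) mulrA -pC -mulrA.
Qed.

(** The basis row e_k^T, with the same convention as [basis_col]. *)
Definition basis_row k : 'rV[R]_n.+1 := delta_mx 0 (inord k).

Lemma basis_row_companion k : (k < n)%N ->
  basis_row k.+1 *m D = basis_row k - g`_k.+1 *: basis_row n.
Proof.
move=> lt_kn; apply/rowP=> j; rewrite -rowE !mxE inordK // -!val_eqE /=.
rewrite !inordK // ?(leq_trans lt_kn) //.
case: (j =P n :> nat) => [->|_]; first by rewrite (gtn_eqF lt_kn) mulr1 add0r.
by rewrite mulr0 subr0 eqSS eq_sym.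
Qed.

(** The last basis row is a cyclic vector for the right action of D, because
    e_k^T = e_(k+1)^T D + g_(k+1) e_n^T for k < n. *)
Lemma basis_row_cyclic (r : 'rV[R]_n.+1) :
  exists q, r = delta_mx 0 ord_max *m horner_mx D q.
Proof.
have row_n : basis_row n = delta_mx 0 ord_max.
  by congr delta_mx; apply/val_inj; rewrite /= inordK.
have rowP k : exists q,
    (k <= n)%N -> basis_row (n - k)%N = basis_row n *m horner_mx D q.
  elim: k => [|k [q IHk]]; first by exists 1; rewrite subn0 rmorph1 mulmx1.
  exists (q * 'X + (g`_(n - k)%N)%:P) => lt_kn.
  have lt_k : (n - k.+1 < n)%N by rewrite ltn_subrL (leq_ltn_trans _ lt_kn).
  rewrite [horner_mx _ _]rmorphD rmorphM /= horner_mx_X horner_mx_C mulmxDr.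
  rewrite [basis_row n *m _]mulmxA -IHk ?(ltnW lt_kn) //.
  rewrite -(subnSK lt_kn) basis_row_companion //.
  by rewrite mul_mx_scalar subrK.
have [q qP] := choice rowP.
exists (\sum_(j < n.+1) r 0 j *: q (n - j)%N).
rewrite -row_n [horner_mx _ _]raddf_sum mulmx_sumr [LHS]row_sum_delta.
apply: eq_bigr => j _ /=; rewrite linearZ /= -scalemxAr -qP ?leq_subr //.
by rewrite subKn ?leq_ord // /basis_row inord_val.
Qed.

Lemma companion_sub_mulmx (A : 'M[R]_n.+1) :
  exists q, (D - C) *m A = (D - C) *m horner_mx D q.
Proof.
rewrite companion_sub; have [q q_eq] := basis_row_cyclic (delta_mx 0 ord_max *m A).
by exists q; rewrite -!mulmxA q_eq.
Qed.

(** The matrices in the sum of the R[C] D^i, for 0 <= i <= n. *)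
Definition in_span (A : 'M[R]_n.+1) : Prop :=
  exists p : 'I_n.+1 -> {poly R}, A = \sum_i horner_mx C (p i) *m D ^+ i.

Lemma in_span_add A B : in_span A -> in_span B -> in_span (A + B).
Proof.
move=> [p ->] [q ->]; exists (fun i => p i + q i); rewrite -big_split /=.
by apply: eq_bigr => i _; rewrite rmorphD /= mulmxDl.
Qed.

Lemma in_span_horner_mul p A : in_span A -> in_span (horner_mx C p *m A).
Proof.
move=> [q ->]; exists (fun i => p * q i); rewrite mulmx_sumr.
by apply: eq_bigr => i _; rewrite mulmxA rmorphM.
Qed.

(** Powers of D beyond the n-th are removed by reducing modulo g. *)
Lemma in_span_horner q : in_span (horner_mx D q).
Proof.
rewrite (Pdiv.RingMonic.rdivp_eq g_monic q) rmorphD rmorphM /=.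
rewrite horner_companion_self // mulr0 add0r.
exists (fun i => ((Pdiv.Ring.rmodp q g)`_i)%:P).
have le_r : (size (Pdiv.Ring.rmodp q g) <= n.+1)%N.
  by rewrite -ltnS -g_size Pdiv.Ring.ltn_rmodpN0 ?monic_neq0.
rewrite (horner_mx_sum D le_r).
by apply: eq_bigr => i _; rewrite horner_mx_C mul_scalar_mx.
Qed.

(** The crucial stability: D need not commute with C, but the correction
    (D - C) A can be rewritten as (D - C) q(D). *)
Lemma in_span_mul_companion A : in_span A -> in_span (D *m A).
Proof.
move=> A_span; have [q q_eq] := companion_sub_mulmx A.
have -> : D *m A = C *m A + (D *m horner_mx D q - C *m horner_mx D q).
  by rewrite -mulmxBl -q_eq -mulmxDl addrC subrK.
have D_q : D *m horner_mx D q = horner_mx D ('X * q).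
  by rewrite rmorphM /= horner_mx_X.
have C_X : C = horner_mx C 'X by rewrite horner_mx_X.
rewrite D_q {1 2}C_X -mulmxN; apply: in_span_add; first exact: in_span_horner_mul.
apply: in_span_add; first exact: in_span_horner.
by apply: in_span_horner_mul; rewrite -rmorphN; apply: in_span_horner.
Qed.

(** The matrices that preserve the span by left multiplication form a subalgebra
    containing C and D, hence R<C,D>; apply its elements to 1. *)
Lemma gen_alg_companions A : gen_alg [set C; D]%classic A -> in_span A.
Proof.
pose T := [set B | forall A, in_span A -> in_span (B *m A)]%classic.
move=> A_gen; have -> : A = A *m horner_mx D 1 by rewrite rmorph1 mulmx1.
suff TA : T A by apply/TA/in_span_horner.
apply: A_gen; split=> [|_ [->|->] B]; last exact: in_span_mul_companion.
  split=> [|a u v|u v]; rewrite !inE /T /=.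
  - by move=> B; rewrite mul1mx.
  - move=> uT vT B B_span; rewrite mulmxDl -scalemxAl -mul_scalar_mx -(horner_mx_C C).
    by apply: in_span_add (vT _ B_span); apply/in_span_horner_mul/uT.
  - by move=> uT vT B B_span; rewrite -mulmxA; apply/uT/vT.
by rewrite -(horner_mx_X C); apply: in_span_horner_mul.
Qed.

(** The two hypotheses on h say that the r such that f divides r g are exactly
    the multiples of h. *)
Lemma companion_sum_independent h (p : 'I_n -> {poly R}) q :
    (exists u, h * g = u * f) ->
    (forall r, (exists u, r * g = u * f) -> exists u, r = u * h) ->
    \sum_(j < n) horner_mx C (p j) *m D ^+ j.+1 = horner_mx C q ->
  forall j, exists u, p j = u * h.
Proof.
move=> h_g h_min sum_eq.
have exp0 (e : {poly R}) (k : 'I_n) :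
    companion n e ^+ k.+1 *m basis_col 0 = basis_col k.+1.
  by rewrite companion_exp_basis ?add0n.
have sumC : \sum_(j < n) horner_mx C (p j) *m C ^+ j.+1 = horner_mx C q.
  pose s := \sum_(j < n) p j * 'X^(j.+1) - q.
  have sE : horner_mx C s =
      \sum_(j < n) horner_mx C (p j) *m C ^+ j.+1 - horner_mx C q.
    rewrite rmorphB rmorph_sum /=; congr (_ - _); apply: eq_bigr => j _.
    by rewrite rmorphM rmorphXn /= horner_mx_X.
  have [|u s_eq] := @horner_companion_basis0_eq0 f s f_monic f_size.
    rewrite sE -sum_eq mulmxBl !mulmx_suml; apply/eqP; rewrite subr_eq0; apply/eqP.
    by apply: eq_bigr => j _; rewrite -!mulmxA !exp0.
  apply/eqP; rewrite -subr_eq0 -sE s_eq rmorphM /= horner_companion_self //.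
  by rewrite mulr0.
have sum0 : \sum_(j < n) horner_mx C (p j) *m (D ^+ j.+1 - C ^+ j.+1) = 0.
  under eq_bigr => j _ do rewrite mulmxBr.
  by rewrite sumrB sum_eq sumC subrr.
(* Downward induction on j: k bounds n - j. *)
suff pP k (j : 'I_n) : (n <= j + k)%N -> exists u, p j = u * h.
  by move=> j; apply: (pP n); rewrite leq_addl.
elim: k j => [|k IHk] j; first by rewrite addn0 leqNgt ltn_ord.
rewrite addnS => le_njk; apply: h_min.
have le_j : (j <= n)%N := ltnW (ltn_ord j).
(* Only the term of index j survives on e_(n - j): the powers of exponent
   i.+1 <= j still act as shifts on it, and the terms of index i > j vanish by
   the induction hypothesis. *)
have /(congr1 (mulmx^~ (basis_col (n - j)))) := sum0.
rewrite mul0mx mulmx_suml (bigD1 j) //= [X in _ + X]big1 => [|i ne_ij]; last first.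
  have [lt_ij|le_ji] := ltnP i j.
    have le_i : (n - j + i.+1 <= n)%N by rewrite -leq_subRL ?leq_subr // subKn.
    by rewrite -mulmxA mulmxBl !companion_exp_basis // subrr mulmx0.
  have lt_ji : (j < i)%N by rewrite ltn_neqAle eq_sym ne_ij.
  have [|u pi_eq] := IHk i; first by rewrite (leq_trans le_njk) // -addSn leq_add2r.
  rewrite mulmxBr horner_mul_companion_exp ?subrr ?mul0mx //.
  by have [w h_eq] := h_g; exists (u * w); rewrite pi_eq -mulrA h_eq mulrA.
rewrite addr0 -mulmxA mulmxBl !exprS -![_ * _ *m _]mulmxA.
rewrite !companion_exp_basis ?subnK // !companion_basis_last.
have -> : - coef_col g - - coef_col f = coef_col (f - g).
  by apply/colP=> i; rewrite !mxE coefB opprK addrC.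
rewrite -(horner_companion_basis0 f) ?size_monic_sub // mulmxA.
rewrite -[_ *m horner_mx _ _]/(horner_mx C (p j) * horner_mx C (f - g)) -rmorphM.
move=> pj0.
have [u pj_eq] := horner_companion_basis0_eq0 f_monic f_size pj0.
by exists (p j - u); rewrite mulrBl -pj_eq mulrBr subKr.
Qed.

End Pair.
End CompanionMatrix.

(** * The quotient module *)

Section CyclicDecompositionCriterion.
Variables (S : comNzRingType) (V : lmodType S) (k : nat).

(** Generators x_i whose relations are generated by the a_i x_i = 0 give a
    cyclic decomposition. *)
Lemma cyclic_decompositionP (x : 'I_k -> V) (a : 'I_k -> S) :
    (forall v, exists p : 'I_k -> S, v = \sum_i p i *: x i) ->
    (forall p : 'I_k -> S,
       \sum_i p i *: x i = 0 -> forall i, exists b, p i = b * a i) ->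
    (forall i, a i *: x i = 0) ->
  cyclic_decomposition x a.
Proof.
move=> x_gen x_rel ax0.
have comp0 p : \sum_i p i *: x i = 0 -> forall i, p i *: x i = 0.
  by move=> /x_rel p_rel i; have [b ->] := p_rel i; rewrite -scalerA ax0 scaler0.
split=> [v|i].
  have [p v_eq] := x_gen v; exists [ffun i => p i *: x i]; split.
    split=> [i|]; first by rewrite ffunE; exists (p i).
    by rewrite v_eq; apply: eq_bigr => i _; rewrite ffunE.
  move=> w [w_cyc v_eq'].
  have [q q_eq] : {q : 'I_k -> S & forall i, q i *: x i = w i}.
    apply: (choice (P := fun i b => b *: x i = w i)) => i.
    by have [b _ b_eq] := w_cyc i; exists b.
  apply/ffunP=> i; rewrite ffunE -q_eq; apply/eqP; rewrite -subr_eq0 -scalerBl.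
  apply/eqP; apply: (comp0 (fun i => p i - q i)).
  under eq_bigr => j _ do rewrite scalerBl q_eq.
  by rewrite sumrB -v_eq -v_eq' subrr.
apply/seteqP; split=> [b bx0|_ [b _ <-]]; last first.
  by rewrite /annihilator /= -scalerA ax0 scaler0.
have [|c c_eq] := x_rel (fun j => if j == i then b else 0) _ i; last first.
  by rewrite eqxx in c_eq; exists c.
rewrite (bigD1 i) //= eqxx bx0 add0r big1 // => j /negPf->.
by rewrite scale0r.
Qed.

End CyclicDecompositionCriterion.

(** The algebra R[C] consists of the polynomials in C. *)
Lemma gen_alg1 (R : comNzRingType) n (C : 'M[R]_n.+1) A :
  gen_alg [set C]%classic A -> exists p, A = horner_mx C p.
Proof.
pose T := [set B | exists p, B = horner_mx C p]%classic.
move=> A_gen; suff: T A by []; apply: A_gen.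
split=> [|_ ->]; last by exists 'X; rewrite horner_mx_X.
split=> [|a u v|u v]; rewrite !inE /T /=.
- by exists 1; rewrite rmorph1.
- by move=> [p ->] [q ->]; exists (a *: p + q); rewrite linearP.
- by move=> [p ->] [q ->]; exists (p * q); rewrite rmorphM.
Qed.

(** Equality in M = R<C,D>/R[C] of the class of a and of a combination of the
    classes of D, ..., D^n, expressed in terms of matrices. *)
Lemma quot_algCD_eqP (R : comNzRingType) n (C D : 'M[R]_n.+1) (a : algCD C D)
    (p : 'I_n -> {poly R}) :
  quot_proj (algC_in_algCD_submod C D) a =
    \sum_(j < n) p j *: (expD_class C D j.+1 : quot_algCD C D) <->
  exists q, val a =
    \sum_(j < n) horner_mx C (p j) *m D ^+ j.+1 + horner_mx C q :> 'M_n.+1.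
Proof.
pose b : algCD C D :=
  \sum_(j < n) p j *: Sub (D ^+ j.+1 : mx_via C) (expD_algCD C D j.+1).
have val_scale q (c : algCD C D) :
    val (q *: c) = horner_mx C q *m val c :> 'M_n.+1.
  exact: (linearZZ (val : {linear algCD C D -> mx_via C}) q c).
have b_val : val b = \sum_(j < n) horner_mx C (p j) *m D ^+ j.+1 :> 'M_n.+1.
  by rewrite /b raddf_sum; apply: eq_bigr => j _; exact: val_scale.
have -> : \sum_(j < n) p j *: (expD_class C D j.+1 : quot_algCD C D) =
    quot_proj (algC_in_algCD_submod C D) b.
  by rewrite /b raddf_sum; apply: eq_bigr => j _; exact: quot_scale_proj.
rewrite quot_projP unfold_in /algC_in_algCD raddfB /= -b_val; split.
  by rewrite inE => /gen_alg1[q q_eq]; exists q; rewrite -q_eq addrC subrK.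
by case=> q ->; rewrite addrC addKr inE; apply: horner_gen_alg.
Qed.

Lemma quot_algCD_sum_eq0 (R : comNzRingType) n (C D : 'M[R]_n.+1)
    (p : 'I_n -> {poly R}) :
  \sum_(j < n) p j *: (expD_class C D j.+1 : quot_algCD C D) = 0 <->
  exists q, \sum_(j < n) horner_mx C (p j) *m D ^+ j.+1 = horner_mx C q.
Proof.
have val0 : val (0 : algCD C D) = 0 :> 'M_n.+1 by exact: raddf0.
have proj0 : quot_proj (algC_in_algCD_submod C D) 0 = 0 by exact: raddf0.
have sumP := quot_algCD_eqP (0 : algCD C D) p.
rewrite proj0 val0 in sumP; split=> [/esym/sumP[q q_eq]|[q q_eq]].
  exists (- q); rewrite rmorphN; apply/eqP; rewrite -addr_eq0 -q_eq.
  exact: eqxx.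
by apply/esym/sumP; exists (- q); rewrite rmorphN q_eq subrr.
Qed.

(** * Integrality of the coefficients of monic divisors *)

Lemma irreducible_dvdp (F : fieldType) (p : {poly F}) :
  (1 < size p)%N -> exists2 q, irreducible_poly q & q %| p.
Proof.
have [m] := ubnP (size p); elim: m p => // m IHm p le_pm p_gt1.
have [p_irr|/not_andP[] //] := EM (irreducible_poly p); first by exists p.
move=> /existsNP[q /not_implyP[q_neq1 /not_implyP[q_p /negP q_neqp]]].
have p_neq0 : p != 0 by rewrite -size_poly_gt0 ltnW.
have lt_qp : (size q < size p)%N.
  rewrite ltn_neqAle dvdp_leq // andbT; apply: contra q_neqp.
  by rewrite dvdp_size_eqp.
have q_gt1 : (1 < size q)%N.
  by rewrite ltn_neqAle eq_sym q_neq1 size_poly_gt0 (dvdpN0 q_p).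
have [r r_irr r_q] := IHm q (leq_trans lt_qp le_pm) q_gt1.
by exists r; rewrite ?(dvdp_trans r_q).
Qed.

(** By induction on the degree of p, for all fields K at once: over an extension
    with a root z of p, the polynomial p is (X - z) s where z is integral, as a
    root of f, and s is a smaller monic divisor of f. *)
Lemma integral_coef_dvdp (R : comNzRingType) (K : fieldType)
    (RtoK : {rmorphism R -> K}) (f : {poly R}) (p : {poly K}) :
    f \is monic -> p \is monic -> p %| map_poly RtoK f ->
  forall i, integralOver RtoK p`_i.
Proof.
move=> f_mon; have [m] := ubnP (size p).
elim: m K RtoK p => // m IHm K RtoK p le_pm p_mon p_f i.
have [p_le1|p_gt1] := leqP (size p) 1.
  have p1 := size1_polyC p_le1; move: p_mon; rewrite p1 monicE lead_coefC => /eqP->.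
  by rewrite coefC; case: eqP => _; [apply: integral1 | apply: integral0].
have [q q_irr q_p] := irreducible_dvdp p_gt1.
have [L _ [z qz0 _]] := irredp_FAdjoin q_irr.
pose iota : {rmorphism K -> L} := in_alg L.
pose RtoL : {rmorphism R -> L} := iota \o RtoK.
have fL : map_poly RtoL f = map_poly iota (map_poly RtoK f).
  by rewrite -map_poly_comp.
have [s p_eq] : exists s, map_poly iota p = s * ('X - z%:P).
  apply/factor_theorem; move: qz0; rewrite -!dvdp_XsubCl => /dvdp_trans; apply.
  by rewrite dvdp_map.
have s_mon : s \is monic.
  by rewrite -(monicMr _ (monicXsubC z)) -p_eq map_monic.
have s_f : s %| map_poly RtoL f.
  rewrite fL (dvdp_trans _ (_ : map_poly iota p %| _)) ?dvdp_map //.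
  by rewrite p_eq dvdp_mulr.
have lt_sm : (size s < m)%N.
  rewrite -ltnS (leq_trans _ le_pm) // -(size_map_poly iota p) p_eq.
  by rewrite size_Mmonic ?monic_neq0 ?monicXsubC // size_XsubC addn2.
have s_int := IHm L RtoL s lt_sm s_mon s_f.
have z_int : integralOver RtoL z.
  exists f => //; move: qz0; rewrite fL -!dvdp_XsubCl => /dvdp_trans; apply.
  by rewrite dvdp_map (dvdp_trans q_p).
(* The coefficients of s (X - z) are integral in L; as K embeds in L, the same
   equation shows that those of p are integral in K. *)
have [P P_mon] : integralOver RtoL (iota p`_i).
  rewrite -coef_map p_eq mulrBr coefB coefMC coefMX.
  apply: integral_sub; last exact: integral_mul.
  by case: (i == 0)%N; [apply: integral0 | apply: s_int].
rewrite map_poly_comp fmorph_root; by exists P.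
Qed.

(** * The cofactor of the greatest common divisor *)

Section Fractions.
Variable R : idomainType.
Implicit Types f g h p q : {poly R}.

Lemma size_frac_poly p : size (frac_poly p) = size p.
Proof.
by apply: size_map_inj_poly => [x y /eqP|]; rewrite ?tofrac_eq ?rmorph0 => // /eqP.
Qed.

Lemma frac_poly_monic p : (frac_poly p \is monic) = (p \is monic).
Proof.
rewrite !monicE !lead_coefE size_frac_poly coef_map.
by rewrite -(rmorph1 (@tofrac R)) tofrac_eq.
Qed.

Lemma frac_polyM p q : frac_poly (p * q) = frac_poly p * frac_poly q.
Proof. exact: rmorphM. Qed.

(** Divisibility by a monic polynomial descends from the field of fractions, as
    the division with remainder is already possible over R. *)
Lemma frac_poly_dvdp p q :
  p \is monic -> frac_poly p %| frac_poly q -> exists u, q = u * p.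
Proof.
move=> p_mon; have q_eq := Pdiv.RingMonic.rdivp_eq p_mon q.
set r := Pdiv.Ring.rmodp q p in q_eq; set u := Pdiv.Ring.rdivp q p in q_eq.
have lt_rp : (size r < size p)%N by rewrite Pdiv.Ring.ltn_rmodpN0 ?monic_neq0.
rewrite q_eq [frac_poly (_ + _)]rmorphD /= -!/(frac_poly _) frac_polyM.
rewrite dvdp_addr ?dvdp_mull // => p_r.
exists u; suff -> : r = 0 by rewrite addr0.
apply/eqP; apply: contraLR lt_rp => r_neq0; rewrite -leqNgt -!size_frac_poly.
by rewrite dvdp_leq // -size_poly_gt0 size_frac_poly size_poly_gt0.
Qed.

Lemma monic_gcdp_eqp (F : fieldType) (p q : {poly F}) :
  p != 0 -> monic_gcdp p q %= gcdp p q.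
Proof.
move=> p_neq0; rewrite eqp_scale // invr_eq0 lead_coef_eq0 gcdp_eq0.
by rewrite negb_and p_neq0.
Qed.

Lemma monic_gcdp_monic (F : fieldType) (p q : {poly F}) :
  p != 0 -> monic_gcdp p q \is monic.
Proof.
move=> p_neq0; rewrite monicE lead_coefZ mulVf // lead_coef_eq0 gcdp_eq0.
by rewrite negb_and p_neq0.
Qed.

Section Cofactor.
Variables f g : {poly R}.
Hypothesis f_monic : f \is monic.
Let d := monic_gcdp (frac_poly f) (frac_poly g).

Let f_neq0 : frac_poly f != 0.
Proof. by rewrite monic_neq0 ?frac_poly_monic. Qed.
Let d_f : d %| frac_poly f.
Proof. by rewrite (eqp_dvdl _ (monic_gcdp_eqp _ f_neq0)) dvdp_gcdl. Qed.
Let d_g : d %| frac_poly g.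
Proof. by rewrite (eqp_dvdl _ (monic_gcdp_eqp _ f_neq0)) dvdp_gcdr. Qed.

Lemma cofactor_monic : frac_poly f %/ d \is monic.
Proof.
rewrite -(monicMr _ (monic_gcdp_monic (frac_poly g) f_neq0)).
by rewrite divpK ?frac_poly_monic.
Qed.

Lemma integrally_closed_cofactor :
  integrally_closed R -> exists h, frac_poly h = frac_poly f %/ d.
Proof.
set p := frac_poly f %/ d => R_int.
have p_f : p %| map_poly (@tofrac R) f.
  by rewrite -[map_poly _ _](divpK d_f) dvdp_mulr.
have p_int := integral_coef_dvdp f_monic cofactor_monic p_f.
have [c c_eq] := choice (fun i => R_int _ (p_int i)).
exists (\poly_(i < size p) c i); apply/polyP=> i; rewrite coef_map coef_poly.
by case: ltnP => [_|/leq_sizeP->//]; rewrite ?rmorph0.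
Qed.

Variable h : {poly R}.
Hypothesis h_eq : frac_poly h = frac_poly f %/ d.

(** With [cofactor_min]: the r such that f divides r g are the multiples of h. *)
Lemma cofactor_mul : exists u, h * g = u * f.
Proof.
apply: frac_poly_dvdp => //; rewrite frac_polyM -(divpK d_f) -h_eq.
by rewrite dvdp_mul.
Qed.

Lemma cofactor_min r : (exists u, r * g = u * f) -> exists u, r = u * h.
Proof.
case=> u rg_eq; apply: frac_poly_dvdp.
  by rewrite -frac_poly_monic h_eq cofactor_monic.
have d_neq0 : d != 0 by rewrite monic_neq0 ?monic_gcdp_monic.
have h_cop : coprimep (frac_poly h) (frac_poly g %/ d).
  have d_eqp := monic_gcdp_eqp (frac_poly g) f_neq0.
  rewrite h_eq (eqp_coprimepl _ (eqp_divr _ d_eqp)).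
  rewrite (eqp_coprimepr _ (eqp_divr _ d_eqp)).
  by rewrite coprimep_div_gcd // f_neq0.
rewrite -(Gauss_dvdpl _ h_cop) -(dvdp_mul2r _ _ d_neq0) -mulrA divpK //.
by rewrite h_eq divpK // -frac_polyM rg_eq frac_polyM dvdp_mull.
Qed.

End Cofactor.
End Fractions.

Theorem theorem9p1 (R : idomainType) (n : nat) (f g : {poly R})
    (f_monic : f \is monic) (g_monic : g \is monic)
    (f_size : size f = n.+2) (g_size : size g = n.+2) :
  let C := companion n f in
  let D := companion n g in
  let d := monic_gcdp (frac_poly f) (frac_poly g) in
  let hF := frac_poly f %/ d in
  (integrally_closed R -> exists h : {poly R}, frac_poly h = hF) /\
  (forall h : {poly R}, frac_poly h = hF ->
     cyclic_decomposition (fun j : 'I_n => expD_class C D j.+1) (fun=> h) /\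
     invariant_factors (quot_algCD C D) (nseq n h)).
Proof.
move=> C D d hF; split; first exact: integrally_closed_cofactor.
move=> h h_eq.
have h_g := cofactor_mul f_monic h_eq.
have h_min := cofactor_min f_monic h_eq.
have decomp : cyclic_decomposition (fun j : 'I_n => expD_class C D j.+1) (fun=> h).
  apply: cyclic_decompositionP => [v|p|j].
  - have A_gen : gen_alg [set C; D]%classic (val (quot_repr v)).
      by have := valP (quot_repr v); rewrite inE.
    have [p p_eq] := gen_alg_companions g_monic g_size A_gen.
    exists (fun j => p (lift ord0 j)); rewrite -[LHS]quot_reprK.
    apply/quot_algCD_eqP; exists (p ord0).
    by rewrite p_eq big_ord_recl expr0 mulmx1 addrC.
  - move=> /quot_algCD_sum_eq0[q]; exact: companion_sum_independent.
  pose p i := if i == j then h else 0.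
  have -> : h *: (expD_class C D j.+1 : quot_algCD C D) =
      \sum_(i < n) p i *: (expD_class C D i.+1 : quot_algCD C D).
    rewrite (bigD1 j) //= /p eqxx big1 ?addr0 // => i /negPf->.
    by rewrite scale0r.
  apply/quot_algCD_sum_eq0; exists (h * 'X^(j.+1)).
  rewrite (bigD1 j) //= /p eqxx big1 ?addr0 => [|i /negPf->]; last first.
    by rewrite rmorph0 mul0mx.
  by rewrite horner_mul_companion_exp // rmorphM rmorphXn /= horner_mx_X.
have nth_h (i : 'I_(size (nseq n h))) : (nseq n h)`_i = h.
  by have /nseqP[] := mem_nth 0 (ltn_ord i).
split=> //; split=> [i j _|]; first by exists 1; rewrite mul1r !nth_h.
rewrite (funext nth_h) size_nseq.
by exists (fun j : 'I_n => expD_class C D j.+1).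
Qed.
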